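(* Let $n\ge 1$ and $0\le m\le n$ be integers. Then $\mathcal{L}_{m,n}$ is exactly the set of real symmetric $n\times n$ matrices that have an eigenvalue of multiplicity at least $n-m$.
   Context: $\mathcal{L}_{m,n}$ denotes the set of real $n\times n$ matrices $M$ that can be written as $M=\alpha I+\sum_{i=1}^m a_iu_iu_i^T$ with scalars $\alpha,a_1,\dots,a_m\in\mathbb{R}$ and column vectors $u_1,\dots,u_m\in\mathbb{R}^n$. *)

(* Defs.v *)
From HB Require Import structures.
From mathcomp Require Import all_boot all_order all_algebra.
From mathcomp Require Import classical_sets reals.

Set Implicit Arguments.
Unset Strict Implicit.
Unset Printing Implicit Defensive.

Import Order.TTheory GRing.Theory Num.Theory.
Local Open Scope classical_set_scope.
Local Open Scope ring_scope.

Definition Lset (R : realType) (m n : nat) : set 'M[R]_n :=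
  [set M | exists (alpha : R) (a : 'I_m -> R) (u : 'I_m -> 'cV[R]_n),
     M = alpha%:M + \sum_(i < m) a i *: (u i *m (u i)^T)].

Arguments Lset R m n : clear implicits.

(* Algebraic multiplicity: the order of vanishing of the characteristic
   polynomial at lambda. *)
Definition eigen_mult (R : realType) (n : nat) (M : 'M[R]_n) (lambda : R) :
    nat :=
  mup lambda (char_poly M).

(* Main.v *)
(* Let [M] be symmetric.  By the spectral theorem the algebraic multiplicity of
   [lambda] as an eigenvalue of [M] is [n - \rank (M - lambda%:M)], so both
   sides say that [M - lambda%:M] has rank at most [m] for some [lambda]:
   Lagrange's reduction of quadratic forms writes a symmetric matrix of rank
   [r] as a sum of [r] multiples of squares [u *m u^T].  When [m = n] the
   multiplicity condition is void and only the existence of a real eigenvalue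
   is needed. *)
Require Import Defs.
From mathcomp Require Import all_boot all_order all_algebra.
From mathcomp Require Import classical_sets reals.
From mathcomp Require Import boolp complex.

Set Implicit Arguments.
Unset Strict Implicit.
Unset Printing Implicit Defensive.

Import Order.TTheory GRing.Theory Num.Theory.
Local Open Scope classical_set_scope.
Local Open Scope ring_scope.

Lemma symmetricmxP (R : fieldType) (n : nat) (M : 'M[R]_n) :
  reflect (M^T = M) (M \is symmetricmx).
Proof.
apply: (iffP (is_hermitianmxP _ _ _)); rewrite expr0 scale1r map_mx_id //.
Qed.

Lemma char_poly_conj (F : fieldType) (n : nat) (P A : 'M[F]_n) :
  P \in unitmx -> char_poly (invmx P *m A *m P) = char_poly A.
Proof.
move=> Pu; pose Q : 'M[{poly F}]_n := map_mx polyC P.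
pose Q' : 'M[{poly F}]_n := map_mx polyC (invmx P).
have Q'Q : Q' *m Q = 1%:M by rewrite -map_mxM mulVmx // map_mx1.
have -> : char_poly (invmx P *m A *m P) = \det (Q' *m char_poly_mx A *m Q).
  congr (\det _); rewrite /char_poly_mx mulmxBr mulmxBl -!map_mxM.
  by rewrite scalar_mxC -(mulmxA _ Q') Q'Q mulmx1.
by rewrite !det_mulmx mulrAC -det_mulmx Q'Q det1 mul1r.
Qed.

(** The row space is the direct sum of the coordinate lines that carry a nonzero diagonal entry. *)
Lemma mxrank_diag (F : fieldType) (n : nat) (d : 'rV[F]_n) :
  \rank (diag_mx d) = #|[pred i | d 0 i != 0]|.
Proof.
have eqd : (diag_mx d :=: \sum_(i | d 0 i != 0) <<delta_mx 0 i : 'rV[F]_n>>)%MS.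
  apply/eqmxP/andP; split.
    apply/row_subP => i; rewrite row_diag_mx.
    have [->|di0] := eqVneq (d 0 i) 0; first by rewrite scale0r sub0mx.
    by rewrite scalemx_sub // (sumsmx_sup i) // genmxE.
  apply/sumsmx_subP => i di0; rewrite genmxE.
  have -> : delta_mx 0 i = (d 0 i)^-1 *: row i (diag_mx d).
    by rewrite row_diag_mx scalerA mulVf // scale1r.
  by rewrite scalemx_sub // row_sub.
rewrite eqd (mxdirectP _) /=; last exact: mxdirect_delta.
rewrite (eq_bigr (fun=> 1%N)) ?sum1_card // => i _.
by rewrite genmxE mxrank_delta.
Qed.

Lemma mxrank_conj (F : fieldType) (n : nat) (P A : 'M[F]_n) :
  P \in unitmx -> \rank (invmx P *m A *m P) = \rank A.
Proof.
move=> Pu; rewrite mxrankMfree ?row_free_unit //.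
by rewrite (eqmxMfull A) // row_full_unit unitmx_inv.
Qed.

Lemma mup_prod_XsubC (F : fieldType) (I : finType) (d : I -> F) (x : F) :
  mup x (\prod_i ('X - (d i)%:P)) = #|[pred i | d i == x]|.
Proof.
rewrite (bigID (fun i => d i == x)) /= mupMl; last first.
  rewrite /root horner_prod prodf_seq_neq0; apply/allP => i _; apply/implyP.
  by rewrite !hornerE subr_eq0 eq_sym.
rewrite (eq_bigr (fun=> 'X - x%:P)) => [|i /eqP -> //].
by rewrite prodr_const mup_XsubCX eqxx.
Qed.

(** Over [R[i]] the matrix is Hermitian, so the spectral theorem applies and its spectrum is real.
    The conjugating [P] may stay complex: only characteristic polynomials and ranks are read off
    below, and both are compatible with extending scalars. *)
Lemma symmetric_diagonalization (R : rcfType) (n : nat) (M : 'M[R]_n) :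
  M \is symmetricmx ->
  exists (P : 'M[R[i]]_n) (d : 'rV[R]_n), P \in unitmx /\
    map_mx (real_complex R) M
      = invmx P *m diag_mx (map_mx (real_complex R) d) *m P.
Proof.
move=> /symmetricmxP symM; pose A := map_mx (real_complex R) M.
have hermA : A \is hermsymmx.
  apply: realsym_hermsym; first by apply/symmetricmxP; rewrite map_trmx symM.
  by apply/mxOverP => i j; rewrite mxE complex_real.
exists (spectralmx A), (map_mx (@complex.Re R) (spectral_diag A)).
split; first exact: spectral_unit.
rewrite -map_mx_comp (_ : map_mx _ (spectral_diag A) = spectral_diag A).
  exact/orthomx_spectralP/hermitian_normalmx.
have /mxOverP realD := hermitian_spectral_diag_real hermA.
by apply/matrixP => i j; rewrite mxE /= RRe_real.
Qed.

(** One family [d] serves both claims, which lets algebraic multiplicity be traded for corank. *)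
Lemma char_poly_symmetric (R : rcfType) (n : nat) (M : 'M[R]_n) :
  M \is symmetricmx ->
  exists d : 'I_n -> R, char_poly M = \prod_i ('X - (d i)%:P) /\
    forall x, \rank (M - x%:M) = #|[pred i | d i != x]|.
Proof.
move=> /symmetric_diagonalization[P [d [Pu eqM]]]; exists (d 0); split.
  apply: (map_poly_inj (real_complex R)).
  rewrite map_char_poly eqM char_poly_conj // char_poly_trig ?diag_mx_is_trig //.
  rewrite rmorph_prod; apply: eq_bigr => i _.
  by rewrite /= map_polyXsubC !mxE eqxx mulr1n.
move=> x; rewrite -(mxrank_map (real_complex R)) map_mxB eqM map_scalar_mx.
have -> : (real_complex R x)%:M = invmx P *m (real_complex R x)%:M *m P.
  by rewrite scalar_mxC -mulmxA mulVmx // mulmx1.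
rewrite -mulmxBl -mulmxBr mxrank_conj // -diag_const_mx -linearB mxrank_diag.
apply: eq_card => i; rewrite !inE !mxE.
by rewrite -rmorphB fmorph_eq0 subr_eq0.
Qed.

Lemma eigen_mult_symmetric (R : realType) (n : nat) (M : 'M[R]_n) (x : R) :
  M \is symmetricmx -> eigen_mult M x = (n - \rank (M - x%:M)%R)%N.
Proof.
move=> /char_poly_symmetric[d [chiM rkM]].
rewrite /eigen_mult chiM mup_prod_XsubC rkM.
by rewrite -[n in (n - _)%N]card_ord -(cardC [pred i | d i == x]) addnK.
Qed.

Lemma symmetric_has_eigenvalue (R : rcfType) (n : nat) (M : 'M[R]_n) :
  (0 < n)%N -> M \is symmetricmx -> exists x, eigenvalue M x.
Proof.
move=> n_gt0 /char_poly_symmetric[d [chiM _]]; pose i := Ordinal n_gt0.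
exists (d i); rewrite eigenvalue_root_char chiM /root horner_prod.
by apply/prodf_eq0; exists i; rewrite // !hornerE subrr.
Qed.

(* Polarization at the vectors [e_i + e_j], which gives [2 N_ij = 0]. *)
Lemma symmetric_isotropic_eq0 (R : numFieldType) (n : nat) (N : 'M[R]_n) :
  N^T = N -> (forall v : 'cV_n, v^T *m N *m v = 0) -> N = 0.
Proof.
move=> symN N0; apply/matrixP => i j; rewrite mxE.
have Nij k l : (delta_mx k 0 : 'cV[R]_n)^T *m N *m (delta_mx l 0 : 'cV_n)
                = (N k l)%:M.
  by rewrite trmx_delta -rowE -colE [LHS]mx11_scalar !mxE.
have := N0 (delta_mx i 0 + delta_mx j 0).
rewrite mulmxDr [(_ + _)^T]linearD /= !mulmxDl !N0 add0r addr0 !Nij.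
have -> : N j i = N i j by rewrite -[in LHS]symN mxE.
rewrite -raddfD /= => /(congr1 (fun A : 'M_1 => A 0 0)).
by rewrite !mxE mulr1n -mulr2n => /eqP; rewrite mulrn_eq0 => /eqP.
Qed.

(** Lagrange reduction: pick [v] with [v^T *m N *m v] nonzero and subtract the multiple of
    [w *m w^T], [w = N *m v], that makes [v] a null vector. The rank drops, and induction on the
    bound [m] finishes. *)
Lemma symmetric_sum_squares (R : numFieldType) (n m : nat) (N : 'M[R]_n) :
  N^T = N -> (\rank N <= m)%N ->
  exists (a : 'I_m -> R) (u : 'I_m -> 'cV[R]_n),
    N = \sum_(i < m) a i *: (u i *m (u i)^T).
Proof.
elim: m N => [|m IHm] N symN rkN.
  exists (fun=> 0), (fun=> 0); rewrite big_ord0; apply/eqP.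
  by rewrite -mxrank_eq0 -leqn0.
have [->|N_neq0] := eqVneq N 0.
  by exists (fun=> 0), (fun=> 0); rewrite big1 // => i _; rewrite scale0r.
have [v cN0] : exists v : 'cV_n, v^T *m N *m v != 0.
  apply: contrapT => /forallNP N0; case/eqP: N_neq0; apply: symmetric_isotropic_eq0 => // v.
  by apply/eqP; rewrite -[_ == _]negbK; apply/negP/N0.
pose w := N *m v; pose c := (v^T *m w) 0 0.
have vw : v^T *m w = c%:M by rewrite [LHS]mx11_scalar.
have c0 : c != 0.
  by apply: contraNneq cN0 => c0; rewrite -mulmxA -/w vw c0 raddf0.
have wT : w^T = v^T *m N by rewrite trmx_mul symN.
pose N' := N - c^-1 *: (w *m w^T).
have N'v : N' *m v = 0.
  rewrite mulmxBl -scalemxAl -(mulmxA w) wT -(mulmxA v^T) -/w vw.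
  by rewrite mul_mx_scalar scalerA mulVf // scale1r subrr.
(* Row spaces shrink because [w^T] is a combination of rows of [N], and strictly so: if
   [N = X *m N'], then [N] would kill [v] as [N'] does. *)
have ltN : (N' < N)%MS.
  rewrite ltmxE; apply/andP; split.
    by rewrite addmx_sub // eqmx_opp scalemx_sub // wT mulmxA submxMl.
  apply: contraNN cN0 => /submxP[X ->].
  by rewrite -!mulmxA N'v !mulmx0.
have symN' : N'^T = N' by rewrite linearB /= symN linearZ /= trmx_mul trmxK.
have [a [u eqN']] : exists (a : 'I_m -> R) (u : 'I_m -> 'cV[R]_n),
    N' = \sum_(i < m) a i *: (u i *m (u i)^T).
  by apply: IHm => //; rewrite -ltnS (leq_trans (rank_ltmx ltN)).
(* [unlift] fails only at [ord0], so the defaults [c^-1] and [w] supply the new first term, and the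
   terms of [N'] follow. *)
exists (fun i => oapp a c^-1 (unlift ord0 i)).
exists (fun i => oapp u w (unlift ord0 i)).
rewrite big_ord_recl unlift_none /= (eq_bigr (fun i => a i *: (u i *m (u i)^T))).
  by rewrite -eqN' addrC subrK.
by move=> i _; rewrite liftK.
Qed.

(** The sum factors as an [n] by [m] matrix times an [m] by [n] matrix. *)
Lemma mxrank_sum_squares (F : fieldType) (n m : nat) (a : 'I_m -> F)
    (u : 'I_m -> 'cV[F]_n) :
  (\rank (\sum_(i < m) a i *: (u i *m (u i)^T))%R <= m)%N.
Proof.
have -> : \sum_(i < m) a i *: (u i *m (u i)^T)
    = (\matrix_(k, i) (a i * u i k 0)) *m (\matrix_(i, k) u i k 0).
  apply/matrixP => k l; rewrite summxE !mxE; apply: eq_bigr => i _.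
  by rewrite !mxE big_ord1 mxE mulrA.
by rewrite (leq_trans (mxrankM_maxl _ _)) // rank_leq_col.
Qed.

Theorem proposition2p1 (R : realType) (m n : nat)
    (n_ge1 : (1 <= n)%N) (m_le_n : (m <= n)%N) :
  Lset R m n =
  [set M : 'M[R]_n | M \is symmetricmx /\
     exists lambda : R,
       eigenvalue M lambda /\ (n - m <= eigen_mult M lambda)%N].
Proof.
apply/seteqP; split => M /=.
  move=> [alpha [a [u eqM]]].
  have symM : M \is symmetricmx.
    apply/symmetricmxP; rewrite eqM linearD /= tr_scalar_mx linear_sum /=.
    by congr (_ + _); apply: eq_bigr => i _; rewrite linearZ /= trmx_mul trmxK.
  (* For [m = n] the scalar [alpha] need not be an eigenvalue, so any real eigenvalue is taken
     instead. *)
  split=> //; case: (ltngtP m n) m_le_n => // [m_lt_n|->] _; last first.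
    have [x Mx] := symmetric_has_eigenvalue n_ge1 symM.
    by exists x; rewrite subnn.
  have mult_ge : (n - m <= eigen_mult M alpha)%N.
    rewrite eigen_mult_symmetric // leq_sub2l //.
    by rewrite eqM addrAC subrr add0r mxrank_sum_squares.
  (* Here [n - m] is positive, so the multiplicity bound itself forces [alpha] to be a root. *)
  exists alpha; split=> //; rewrite eigenvalue_root_char.
  apply: contraLR mult_ge => /mupNroot mult0.
  by rewrite /eigen_mult mult0 -ltnNge subn_gt0.
move=> [symM [x [_]]]; rewrite eigen_mult_symmetric // => mult_ge.
have [||a [u eqM]] := @symmetric_sum_squares R n m (M - x%:M).
- by rewrite linearB /= tr_scalar_mx (symmetricmxP _ symM).
(* Truncated subtraction from [n] can be cancelled because the rank is at most [n]. *)
- by rewrite -(@leq_sub2lE n) ?mult_ge ?rank_leq_row.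
by exists x, a, u; rewrite -eqM addrC subrK.
Qed.
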